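(* Let $n=2$ and $d\geq 2$, and work in the polynomial ring $\mathbb C[u_{d0},u_{(d-1)1},\dots,u_{0d}]$ (coordinates on $S^d(\mathbb C^2)$). For $y,v\in\mathbb Z_{\geq0}^2$ with $y_1+y_2=v_1+v_2=d-1$, $y_2\geq1$, $v_1\geq1$, let $$f_{y,v}=u_{y+e_1}u_{v+e_1}-u_{y+2e_1-e_2}u_{v+e_2}+u_{y+e_2}u_{v+e_2}-u_{y+e_1}u_{v-e_1+2e_2},$$ and let $I$ be the ideal generated by all such $f_{y,v}$. Let $\prec$ be the term order given by the weights $\mathrm{weight}(u_{i(d-i)})=i$, $i=0,\dots,d$, with ties broken by the lexicographic order with $u_{d0}\succ u_{(d-1)1}\succ\dots\succ u_{0d}$. Then the polynomials $f_{y,v}$ form a Gröbner basis of $I$ with respect to $\prec$, the variety $\mathcal V(I)\subseteq S^d(\mathbb C^2)$ has dimension $3=\binom{2+1}{2}$, and $I$ is the prime ideal of the odeco variety in $S^d(\mathbb C^2)$.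
   Context: For $T\in S^d(\mathbb C^2)$ and $a=(a_1,a_2)\in\mathbb Z_{\geq0}^2$ with $a_1+a_2=d$, $u_{a}=u_{a_1a_2}=d!\,T_{1\dots1\,2\dots2}$ (index $1$ repeated $a_1$ times, index $2$ repeated $a_2$ times); $e_1,e_2$ are the standard basis vectors. A real tensor $T\in S^d(\mathbb R^2)$ is odeco if $T=\lambda_1v_1^{\otimes d}+\lambda_2v_2^{\otimes d}$ with $v_1,v_2$ an orthonormal basis of $\mathbb R^2$ and $\lambda_1,\lambda_2\in\mathbb R$; the odeco variety is the Zariski closure in $S^d(\mathbb C^2)$ of the set of odeco tensors. *)

(* Defs.v *)
From HB Require Import structures.
From mathcomp Require Import all_boot all_order all_algebra.
From mathcomp Require Import reals.
From mathcomp Require Import complex.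
From mathcomp Require Import mpoly.

Set Implicit Arguments.
Unset Strict Implicit.
Unset Printing Implicit Defensive.

Import Order.TTheory GRing.Theory Num.Theory.
Local Open Scope ring_scope.

Section Odeco.
Variable R : realType.
Local Notation C := (complex R).
Variable d : nat.

(* Polynomial ring C[u_{d0}, u_{(d-1)1}, ..., u_{0d}]: the variable with
   index i : 'I_(d.+1) is u_{i (d-i)}. *)
Definition cpoly := {mpoly C[d.+1]}.

(* u_{k (d-k)} as a polynomial (k is taken <= d below). *)
Definition uvar (k : nat) : cpoly := 'X_(inord k).

(* f_{y,v} with y = (y1, d-1-y1), v = (v1, d-1-v1):
   u_{y+e1} u_{v+e1} - u_{y+2e1-e2} u_{v+e2}
   + u_{y+e2} u_{v+e2} - u_{y+e1} u_{v-e1+2e2}. *)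
Definition fyv (y1 v1 : nat) : cpoly :=
  uvar y1.+1 * uvar v1.+1 - uvar y1.+2 * uvar v1
  + uvar y1 * uvar v1 - uvar y1.+1 * uvar v1.-1.

(* The set of generators: y2 = d-1-y1 >= 1 and v1 >= 1, v1 <= d-1. *)
Definition gens (p : cpoly) : Prop :=
  exists y1 v1 : nat, [/\ (y1 <= d - 2)%N, (1 <= v1)%N, (v1 <= d - 1)%N
                       & p = fyv y1 v1].

Definition ideal_gen (S : cpoly -> Prop) (p : cpoly) : Prop :=
  exists (k : nat) (c g : 'I_k -> cpoly),
    (forall i, S (g i)) /\ p = \sum_(i < k) c i * g i.

Definition Iideal : cpoly -> Prop := ideal_gen gens.

Definition mweight (m : 'X_{1..d.+1}) : nat := (\sum_(i < d.+1) i * m i)%N.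

(* strict lex: the first variable (starting from u_{d0}, i.e. index d,
   going down) at which m and m' differ has larger exponent in m *)
Definition lex_gt (m m' : 'X_{1..d.+1}) : bool :=
  [exists i : 'I_(d.+1),
     (m' i < m i)%N && [forall j : 'I_(d.+1), (i < j)%N ==> (m j == m' j)]].

Definition term_gt (m m' : 'X_{1..d.+1}) : bool :=
  (mweight m' < mweight m)%N || ((mweight m == mweight m') && lex_gt m m').

Definition is_lm (p : cpoly) (m : 'X_{1..d.+1}) : Prop :=
  m \in msupp p /\ forall m', m' \in msupp p -> m' <> m -> term_gt m m'.

Definition groebner_basis (G J : cpoly -> Prop) : Prop :=
  (forall g, G g -> J g) /\
  forall f, J f -> f != 0 -> forall m, is_lm f m ->
    ideal_gen (fun q => exists g m', [/\ G g, g != 0, is_lm g m' & q = 'X_[m']])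
              'X_[m].

Definition is_ideal (P : cpoly -> Prop) : Prop :=
  [/\ P 0, (forall a b, P a -> P b -> P (a + b)) & (forall a b, P b -> P (a * b))].

Definition is_prime_ideal (P : cpoly -> Prop) : Prop :=
  [/\ is_ideal P, ~ P 1 & forall a b, P (a * b) -> P a \/ P b].

(* Dimension of the variety V(J): Krull dimension of C[u]/J, i.e. the
   maximal length n of a chain P_0 < P_1 < ... < P_n of prime ideals
   containing J (by the Nullstellensatz, equivalently the maximal length of
   a chain of irreducible closed subvarieties of V(J)). *)
Definition prime_chain (J : cpoly -> Prop) (n : nat) : Prop :=
  exists P : 'I_n.+1 -> cpoly -> Prop,
    [/\ forall i, is_prime_ideal (P i),
        forall p, J p -> P ord0 p
      & forall i j : 'I_n.+1, (i < j)%N ->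
          (forall p, P i p -> P j p) /\ exists p, P j p /\ ~ P i p].

Definition variety_dim (J : cpoly -> Prop) (n : nat) : Prop :=
  prime_chain J n /\ ~ prime_chain J n.+1.

(* Points of S^d(C^2) in the coordinates u_a = d! T_{1..1 2..2}. *)
Definition point := 'I_(d.+1) -> C.

(* coordinates of the tensor lambda1 v^{(x)d} + lambda2 w^{(x)d} *)
Definition coords (l1 l2 : C) (v w : C * C) : point :=
  fun i => (d`!)%:R * (l1 * v.1 ^+ i * v.2 ^+ (d - i)
                       + l2 * w.1 ^+ i * w.2 ^+ (d - i)).

Definition odeco (u : point) : Prop :=
  exists (l1 l2 a b c e : R),
    [/\ a ^+ 2 + b ^+ 2 = 1, c ^+ 2 + e ^+ 2 = 1, a * c + b * e = 0
      & u = coords (l1%:C)%C (l2%:C)%C ((a%:C)%C, (b%:C)%C) ((c%:C)%C, (e%:C)%C)].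

Definition vanishing_ideal (X : point -> Prop) (p : cpoly) : Prop :=
  forall u, X u -> p.@[u] = 0.

Definition zariski_closure (X : point -> Prop) (u : point) : Prop :=
  forall p, vanishing_ideal X p -> p.@[u] = 0.

Definition odeco_variety : point -> Prop := zariski_closure odeco.

End Odeco.

(* Main.v *)
Require Import Defs.
From HB Require Import structures.
From mathcomp Require Import all_boot all_order all_algebra.
From mathcomp Require Import reals complex mpoly.
From mathcomp Require Import ring lra zify.

(* The generator [fyv] is the 2 x 2 minor
   [u_a (u_(b+1) - u_(b-1)) - u_b (u_(a+1) - u_(a-1))] with [a = y1 + 1] and
   [b = v1], so the variety consists essentially of the solutions of a linear
   recurrence [u_(k+2) = t u_(k+1) + u_k]. This gives a ring morphism [phi] from
   C[u_0, ..., u_d] to C[x, y, t], [x] and [y] being the initial values.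
   The generators rewrite every polynomial into a combination of the monomials
   not divisible by any [u_a u_c] with [0 < a] and [a + 1 < c], which are the
   monomials [u_0^k u_i^p u_(i+1)^q]. Their images under [phi] have the distinct
   leading monomials [x^k y^(p+q) t^((i-1)p+iq)], hence are linearly
   independent: the ideal is the kernel of [phi], which makes it prime, and the
   generators are a Groebner basis.
   When [t], [x], [y] are real the solution of the recurrence is an odeco
   tensor, because the roots [r], [-1/r] of [X^2 - t X - 1] are the slopes of
   two orthogonal lines; so a polynomial vanishing on odeco tensors is in the
   kernel of [phi].
   For the dimension, a chain of primes [P_0 < ... < P_4] provides elements
   [f_i] of [P_i] outside [P_(i-1)] whose monomials are linearly independent
   modulo [P_0], which contradicts the cubic growth of C[x, y, t]; conversely
   specializing successively [x], [t], [y] to 0 gives a chain of length 3. *)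

Set Implicit Arguments.
Unset Strict Implicit.
Unset Printing Implicit Defensive.

Import Order.TTheory GRing.Theory Num.Theory.
Local Open Scope ring_scope.

(** * The term order and standard monomials *)

Section Monomials.
Variable d : nat.
Implicit Types m : 'X_{1..d.+1}.

Lemma lex_gt_trans m2 m1 m3 : lex_gt m1 m2 -> lex_gt m2 m3 -> lex_gt m1 m3.
Proof.
move=> /existsP[i /andP[lti /forallP eqi]] /existsP[j /andP[ltj /forallP eqj]].
have [ltij|leji] := ltnP i j; apply/existsP; [exists j | exists i].
  have /eqP -> := implyP (eqi j) ltij; rewrite ltj /=.
  apply/forallP => k; apply/implyP => ltjk.
  by rewrite (eqP (implyP (eqi k) (ltn_trans ltij ltjk))) (implyP (eqj k)).
have le3 : (m3 i <= m2 i)%N.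
  have [/val_inj <- | neij] := eqVneq (j : nat) (i : nat); first exact: ltnW.
  have ltji : (j < i)%N by rewrite ltn_neqAle neij.
  by rewrite (eqP (implyP (eqj i) ltji)).
rewrite (leq_ltn_trans le3 lti) /=; apply/forallP => k; apply/implyP => ltik.
by rewrite (eqP (implyP (eqi k) ltik)) (implyP (eqj k)) // (leq_ltn_trans leji).
Qed.

Lemma term_gt_trans m2 m1 m3 : term_gt m1 m2 -> term_gt m2 m3 -> term_gt m1 m3.
Proof.
rewrite /term_gt => /orP[lt12|/andP[/eqP-> lex12]] /orP[lt23|/andP[/eqP e23 lex23]].
- by rewrite (ltn_trans lt23 lt12).
- by rewrite -e23 lt12.
- by rewrite lt23.
- by rewrite e23 eqxx (lex_gt_trans lex12 lex23) orbT.
Qed.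

Lemma term_gt_irr m : ~~ term_gt m m.
Proof.
rewrite /term_gt ltnn eqxx /=; apply/negP => /existsP[i /andP[+ _]].
by rewrite ltnn.
Qed.

(** The weight is arbitrary because two are needed: [id] for the term order and the square for the
    termination of the reduction. *)
Lemma weight_addU2 (w : nat -> nat) m (i j : 'I_d.+1) :
  (\sum_(k < d.+1) w k * (m + U_(i) + U_(j))%MM k
   = \sum_(k < d.+1) w k * m k + w i + w j)%N.
Proof.
have wU (l : 'I_d.+1) : (\sum_(k < d.+1) w k * U_(l)%MM k = w l)%N.
  rewrite (bigD1 l) //= mnm1E eqxx muln1 big1 ?addn0 // => k nkl.
  by rewrite mnm1E eq_sym (negbTE nkl) muln0.
under eq_bigr => k _ do rewrite !mnmDE !mulnDr.
by rewrite !big_split /= !wU.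
Qed.

(** When the weights tie, the lexicographic comparison is decided at [c]: both [a'] and [c'] lie
    below it, and beyond [c] the exponents are those of [m]. *)
Lemma term_gt_addU2 m (a c a' c' : 'I_d.+1) :
  (a <= c)%N -> (a' < c)%N -> (c' < c)%N -> (a' + c' <= a + c)%N ->
  term_gt (m + U_(a) + U_(c))%MM (m + U_(a') + U_(c'))%MM.
Proof.
move=> lac lac' lcc' le_w; rewrite /term_gt /Defs.mweight !(weight_addU2 id).
have [eqw|neqw] := eqVneq (a' + c')%N (a + c)%N; last first.
  by rewrite -!addnA ltn_add2l ltn_neqAle neqw le_w.
rewrite -!addnA eqw eqxx /=; apply/orP; right; apply/existsP; exists c.
have neq (i j : 'I_d.+1) : (i < j)%N -> (i == j) = false.
  by move=> lt; apply/negbTE; rewrite -val_eqE /= neq_ltn lt.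
rewrite !mnmDE !mnm1E eqxx (neq a') // (neq c') //.
apply/andP; split; first by lia.
apply/forallP => j; apply/implyP => ltcj.
rewrite !mnmDE !mnm1E !neq //; lia.
Qed.

Definition standard m :=
  [forall i : 'I_d.+1, forall j : 'I_d.+1,
     (0 < i)%N && (i.+1 < j)%N ==> (m i == 0%N) || (m j == 0%N)].

Lemma standardPn m : reflect
  (exists (a c : 'I_d.+1) (m0 : 'X_{1..d.+1}),
     [/\ (0 < a)%N, (a.+1 < c)%N & m = (m0 + U_(a) + U_(c))%MM])
  (~~ standard m).
Proof.
apply: (iffP idP) => [|[a [c [m0 [a0 ac ->]]]]].
  move=> /forallPn[a /forallPn[c]]; rewrite negb_imply negb_or -!lt0n.
  move=> /andP[/andP[a0 ac] /andP[ma mc]].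
  exists a, c, (m - U_(a) - U_(c))%MM; split=> //.
  apply/mnmP => k; rewrite !mnmDE !mnmBE !mnm1E.
  have [<-|] := eqVneq a k.
    by have [e|_] := eqVneq c a; [move: ac; rewrite e; lia | lia].
  by have [<-|_] := eqVneq c k; lia.
apply/forallPn; exists a; apply/forallPn; exists c.
rewrite a0 ac /= !mnmDE !mnm1E !eqxx; lia.
Qed.

(* A standard monomial involves, besides [u_0], at most two consecutive
   variables [u_i], [u_(i+1)], so [i] and the exponent of [u_(i+1)] are the
   quotient and the remainder of its weight by its degree in [u_1, ..., u_d]. *)
Lemma standard_expE m (N := (\sum_(k < d.+1) (0 < k) * m k)%N)
    (W := Defs.mweight m) (j : 'I_d.+1) :
  standard m -> (0 < j)%N ->
  m j = ((j == W %/ N :> nat) * (N - W %% N) + (j == (W %/ N).+1 :> nat) * (W %% N))%N.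
Proof.
move=> std_m j0.
have stdE (i k : 'I_d.+1) : (0 < i)%N -> (i.+1 < k)%N -> (0 < m i)%N -> m k = 0%N.
  move=> i0 ik mi; move/forallP/(_ i)/forallP/(_ k): std_m.
  by rewrite i0 ik /= eqn0Ngt mi => /eqP.
(* If [m] is a power of [u_0], then [N] and [W] are 0 and, by the conventions for division by 0,
   both summands of the formula vanish. *)
case: (pickP (fun i : 'I_d.+1 => (0 < i)%N && (0 < m i)%N)) => [i0 P0 | none]; last first.
  have mz (k : 'I_d.+1) : (0 < k)%N -> m k = 0%N.
    by move=> k0; move: (none k); rewrite k0 /= lt0n => /negbT; rewrite negbK => /eqP.
  have -> : W = 0%N.
    rewrite /W /Defs.mweight big1 // => k _.
    by case: (posnP k) => [->//|/mz ->]; rewrite muln0.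
  have -> : N = 0%N.
    rewrite /N big1 // => k _.
    by case: (posnP k) => [//|/mz ->]; rewrite muln0.
  by rewrite (mz j j0) mod0n !muln0.
pose i := [arg min_(i < i0 | (0 < i)%N && (0 < m i)%N) (i : nat)].
have [ipos mi imin] : [/\ (0 < i)%N, (0 < m i)%N &
    forall k : 'I_d.+1, (0 < k)%N -> (0 < m k)%N -> (i <= k)%N].
  rewrite /i; case: arg_minnP => // k /andP[k0 mk] H; split=> // l l0 ml.
  by apply: H; rewrite l0.
have supp (k : 'I_d.+1) : (0 < k)%N -> (k != i :> nat) -> (k != i.+1 :> nat) -> m k = 0%N.
  move=> k0 ki ki1; apply/eqP; apply: contraT; rewrite -lt0n => mk.
  have := imin k k0 mk; rewrite leq_eqVlt eq_sym (negbTE ki) /= => ltik.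
  by rewrite (stdE i k) // in mk; rewrite ltn_neqAle eq_sym ki1.
(* The exponent of [u_(i+1)], written as a sum so that it is 0 when [i = d]. *)
pose e := (\sum_(k < d.+1 | k == i.+1 :> nat) m k)%N.
have eE (k : 'I_d.+1) : k = i.+1 :> nat -> m k = e.
  move=> ki; rewrite /e (eq_bigl (fun l => l == k)); last first.
    by move=> l; rewrite -ki val_eqE.
  by rewrite big_pred1_eq.
have sumE (w : nat -> nat) : w 0%N = 0%N ->
    (\sum_(k < d.+1) w k * m k = w i * m i + w i.+1 * e)%N.
  move=> w0; rewrite (bigD1 i) //=; congr addn.
  rewrite (bigID (fun k : 'I_d.+1 => k == i.+1 :> nat)) /= [X in (_ + X)%N]big1 ?addn0.
    rewrite /e big_distrr /=; apply: congr_big => // k.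
      by rewrite -val_eqE /=; case: eqP => [->|]; rewrite ?andbF //; lia.
    by move=> /andP[_ /eqP->].
  move=> k /andP[ki ki1]; case: (posnP k) => [->|k0]; first by rewrite w0.
  by rewrite supp ?muln0.
have NE : N = (m i + e)%N by rewrite /N (sumE (fun k => (0 < k)%N : nat)) // ipos; lia.
have WE : W = (i * N + e)%N by rewrite /W /Defs.mweight (sumE id) // NE; lia.
(* Since [m i] is positive, [W = i * N + e] is a Euclidean division by [N]. *)
have eN : (e < N)%N by lia.
have Wq : (W %/ N = i)%N by rewrite WE divnMDl ?divn_small ?addn0 //; lia.
have Wr : (W %% N = e)%N by rewrite WE modnMDl modn_small.
rewrite Wq Wr; have [ji|ji] := eqVneq (j : nat) (i : nat).
  by rewrite (val_inj ji) NE; lia.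
have [ji1|ji1] := eqVneq (j : nat) i.+1; first by rewrite eE //; lia.
by rewrite supp.
Qed.

End Monomials.

(** * Reduction modulo the generators *)

Section Reduction.
Variables (R : realType) (d : nat).
Local Notation C := (complex R).
Implicit Types (m : 'X_{1..d.+1}) (p r : cpoly R d).

Lemma ideal_gen_ideal (S : cpoly R d -> Prop) : is_ideal (ideal_gen S).
Proof.
split.
- by exists 0%N, (fun _ => 0), (fun _ => 0); split=> [[]//|]; rewrite big_ord0.
- move=> _ _ [k1 [c1 [g1 [S1 ->]]]] [k2 [c2 [g2 [S2 ->]]]].
  exists (k1 + k2)%N.
  exists (fun i => match split i with inl j => c1 j | inr j => c2 j end).
  exists (fun i => match split i with inl j => g1 j | inr j => g2 j end).
  split=> [i|]; first by case: (split i).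
  rewrite big_split_ord /=; congr (_ + _); apply: eq_bigr => i _.
    by have := unsplitK (inl i : 'I_k1 + 'I_k2) => /= ->.
  by have := unsplitK (inr i : 'I_k1 + 'I_k2) => /= ->.
- move=> a _ [k [c [g [Sg ->]]]]; exists k, (fun i => a * c i), g; split=> //.
  by rewrite mulr_sumr; apply: eq_bigr => i _; rewrite mulrA.
Qed.

Lemma ideal_gen_sub (S : cpoly R d -> Prop) p : S p -> ideal_gen S p.
Proof.
by move=> Sp; exists 1%N, (fun _ => 1), (fun _ => p); split=> //;
   rewrite big_ord1 mul1r.
Qed.

Lemma fyvE (y v : nat) :
  fyv R d y v = 'X_[U_(inord y.+1) + U_(inord v.+1)]
    - 'X_[U_(inord y.+2) + U_(inord v)] + 'X_[U_(inord y) + U_(inord v)]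
    - 'X_[U_(inord y.+1) + U_(inord v.-1)].
Proof. by rewrite !mpolyXD. Qed.

(** The first two terms have weight [y + v + 2], the last two [y + v]. The tie goes to the term
    containing [u_(v+1)], the largest index present. These leading monomials are exactly the
    products that [standard] forbids. *)
Lemma fyv_lm (y v : nat) : (y.+1 < v < d)%N ->
  is_lm (fyv R d y v) (U_(inord y.+1) + U_(inord v.+1))%MM.
Proof.
move=> /andP[yv vd].
have gt (a c : 'I_d.+1) : (a < v.+1)%N -> (c < v.+1)%N -> (a + c <= y + v + 2)%N ->
    term_gt (U_(inord y.+1) + U_(inord v.+1))%MM (U_(a) + U_(c))%MM.
  move=> av cv ac; have := @term_gt_addU2 d 0%MM (inord y.+1) (inord v.+1) a c.
  by rewrite !add0m !inordK; [apply; lia | lia | lia].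
have gt1 := gt (inord y.+2) (inord v); have gt2 := gt (inord y) (inord v).
have gt3 := gt (inord y.+1) (inord v.-1).
rewrite !inordK in gt1 gt2 gt3; try lia.
have {}gt1 := gt1 ltac:(lia) ltac:(lia) ltac:(lia).
have {}gt2 := gt2 ltac:(lia) ltac:(lia) ltac:(lia).
have {}gt3 := gt3 ltac:(lia) ltac:(lia) ltac:(lia).
have neq m m' : term_gt m m' -> (m' == m) = false.
  by move=> mm'; apply/eqP => e; move: mm'; rewrite e (negbTE (term_gt_irr _)).
split.
  rewrite mcoeff_msupp fyvE !(mcoeffB, mcoeffD, mcoeffX) eqxx !neq //.
  by rewrite subr0 addr0 subr0 oner_eq0.
move=> m'; rewrite fyvE => /msuppB_le; rewrite mem_cat => /orP[/msuppD_le|].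
  rewrite mem_cat => /orP[/msuppB_le|]; rewrite ?mem_cat !msuppX !inE.
    by move=> /orP[/eqP->|/eqP->].
  by move=> /eqP->.
by rewrite msuppX inE => /eqP->.
Qed.

Lemma Iideal_step m (y v : nat) : (y.+1 < v < d)%N ->
  Iideal ('X_[m + U_(inord y.+1) + U_(inord v.+1)]
    - ('X_[m + U_(inord y.+2) + U_(inord v)] - 'X_[m + U_(inord y) + U_(inord v)]
    + 'X_[m + U_(inord y.+1) + U_(inord v.-1)]) : cpoly R d).
Proof.
move=> /andP[yv vd].
have [_ _ IM] := ideal_gen_ideal (@gens R d).
have Ig : Iideal (fyv R d y v).
  by apply: ideal_gen_sub; exists y, v; split=> //; lia.
move: (IM 'X_[m] _ Ig); rewrite /Iideal fyvE -!addmA !mpolyXD.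
by congr ideal_gen; ring.
Qed.

(** The bound on the monomials of [r] ensures that reducing the tail of a polynomial cannot bring
    back its leading monomial. *)
Definition reduces_to p r :=
  Iideal (p - r) /\
  forall m, m \in msupp r -> standard m /\
    exists2 m', m' \in msupp p & m = m' \/ term_gt m' m.

(** The induction is on the sum of the squared indices: each of the three replacements of [u_a u_c]
    brings the indices closer together or lowers one of them, so this sum drops. Well-foundedness of
    the term order is thus avoided. *)
Lemma monomial_reduces m :
  exists r, Iideal ('X_[m] - r) /\
    forall m', m' \in msupp r -> standard m' /\ (m' = m \/ term_gt m m').
Proof.
have [I0 ID IM] := ideal_gen_ideal (@gens R d).
have [n] := ubnP (\sum_(k < d.+1) (k ^ 2) * m k)%N; elim: n => // n IH in m *.
move=> le_n; have [std_m|/standardPn[a [c [m0 [a0 ac mE]]]]] := boolP (standard m).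
  exists 'X_[m]; split; first by rewrite subrr.
  by move=> m'; rewrite msuppX inE => /eqP ->; split=> //; left.
have [y yE] : exists y, y.+1 = a :> nat by exists a.-1; lia.
have [v vE] : exists v, v.+1 = c :> nat by exists c.-1; lia.
have vd : (v < d)%N by have := ltn_ord c; lia.
have aE : a = inord y.+1 by apply: val_inj; rewrite /= inordK //; lia.
have cE : c = inord v.+1 by apply: val_inj; rewrite /= inordK //; lia.
have yv : (y.+1 < v)%N by lia.
have red (a' c' : 'I_d.+1) : (a' <= v)%N -> (c' <= v)%N -> (a' + c' <= y + v + 2)%N ->
    (a' ^ 2 + c' ^ 2 < y.+1 ^ 2 + v.+1 ^ 2)%N ->
    exists r, Iideal ('X_[m0 + U_(a') + U_(c')] - r) /\
      forall m', m' \in msupp r -> standard m' /\ term_gt m m'.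
  move=> av cv acv sq.
  have gt : term_gt m (m0 + U_(a') + U_(c'))%MM.
    by rewrite mE; apply: term_gt_addU2; lia.
  have [|r [Ir Hr]] := IH (m0 + U_(a') + U_(c'))%MM.
    move: le_n; rewrite mE !(weight_addU2 (fun k => k ^ 2)%N) -yE -vE; lia.
  exists r; split=> // m' /Hr[std_m' [e|gt']]; split=> //; first by rewrite e.
  exact: term_gt_trans gt gt'.
have iK k : (k <= v.+1)%N -> (inord k : 'I_d.+1) = k :> nat.
  by move=> kv; rewrite inordK //; lia.
have [||||r1 [I1 H1]] := red (inord y.+2) (inord v); rewrite ?iK; try nia.
have [||||r2 [I2 H2]] := red (inord y) (inord v); rewrite ?iK; try nia.
have [||||r3 [I3 H3]] := red (inord y.+1) (inord v.-1); rewrite ?iK; try nia.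
exists (r1 - r2 + r3); split.
  have := ID _ _ (ID _ _ (ID _ _ (@Iideal_step m0 y v ltac:(lia)) I1)
    (IM (-1) _ I2)) I3.
  rewrite /Iideal mE aE cE; congr ideal_gen; ring.
move=> m' /msuppD_le; rewrite mem_cat => /orP[/msuppB_le|/H3[]]; last by split; auto.
by rewrite mem_cat => /orP[/H1[]|/H2[]]; split; auto.
Qed.

Lemma poly_reduces p : exists r, reduces_to p r.
Proof.
have [I0 ID IM] := ideal_gen_ideal (@gens R d).
rewrite /reduces_to; pose s := msupp p.
have sub : {subset s <= msupp p} by [].
have pE : p = \sum_(m <- s) p@_m *: 'X_[m] by rewrite -mpolyE.
rewrite {1}pE; elim: s sub {pE} => [|m s IH] sub.
  by exists 0; rewrite big_nil subrr; split=> // m; rewrite msupp0.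
have [|r [Ir Hr]] := IH; first by move=> m' ms; apply: sub; rewrite inE ms orbT.
have [r' [Ir' Hr']] := monomial_reduces m.
exists (p@_m *: r' + r); split.
  have := ID _ _ (IM (p@_m)%:MP _ Ir') Ir.
  rewrite big_cons /Iideal; congr ideal_gen.
  by rewrite mul_mpolyC scalerBr opprD addrACA.
move=> m' /msuppD_le; rewrite mem_cat => /orP[/msuppZ_le/Hr'[std_m' mm']|/Hr //].
by split=> //; exists m => //; apply: sub; rewrite inE eqxx.
Qed.

End Reduction.

(** * Auxiliary facts: maxima, linear recurrences, composition of polynomials *)

Lemma seq_argmax (disp : Order.disp_t) (T : eqType) (U : orderType disp)
    (F : T -> U) (s : seq T) : s != [::] ->
  exists2 x, x \in s & forall y, y \in s -> (F y <= F x)%O.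
Proof.
elim: s => // x [|x1 s] IH _.
  by exists x; rewrite ?inE // => y; rewrite inE => /eqP->.
have [//|z zs zmax] := IH.
have [le|/ltW le] := leP (F x) (F z).
  exists z; first by rewrite in_cons zs orbT.
  by move=> y; rewrite in_cons => /orP[/eqP->//|/zmax].
exists x; first exact: mem_head.
by move=> y; rewrite in_cons => /orP[/eqP->//|/zmax /le_trans]; apply.
Qed.

(** The iterated pair holds two consecutive terms. The constant is locked so that simplification
    leaves it folded. *)
HB.lock Definition linrec (A : nzRingType) (t x y : A) (n : nat) : A :=
  (iter n (fun z => (z.2, t * z.2 + z.1)) (x, y)).1.

Section LinearRecurrence.
Variable A : nzRingType.
Implicit Types t x y : A.

Lemma linrec0 t x y : linrec t x y 0 = x.
Proof. by rewrite linrec.unlock. Qed.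

Lemma linrec1 t x y : linrec t x y 1 = y.
Proof. by rewrite linrec.unlock. Qed.

Lemma linrecSS t x y n :
  linrec t x y n.+2 = t * linrec t x y n.+1 + linrec t x y n.
Proof. by rewrite linrec.unlock. Qed.

Lemma linrec_uniq (t : A) (u : nat -> A) (n : nat) :
  (forall k, (k.+2 <= n)%N -> u k.+2 = t * u k.+1 + u k) ->
  forall k, (k <= n)%N -> u k = linrec t (u 0%N) (u 1%N) k.
Proof.
move=> uSS k; have [l] := ubnP k; elim: l k => // l IH [|[|k]] lek kn;
  rewrite ?linrec0 ?linrec1 //.
by rewrite uSS // linrecSS (IH k.+1) ?(IH k) //; lia.
Qed.

End LinearRecurrence.

Lemma rmorph_linrec (A B : nzRingType) (f : {rmorphism A -> B}) t x0 x1 n :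
  f (linrec t x0 x1 n) = linrec (f t) (f x0) (f x1) n.
Proof.
have [l] := ubnP n; elim: l n => // l IH [|[|n]] len; rewrite ?linrec0 ?linrec1 //.
by rewrite !linrecSS rmorphD rmorphM !IH //; lia.
Qed.

Lemma comp_mpolyA (A : comNzRingType) (n k l : nat) (p : {mpoly A[n]})
    (lq : n.-tuple {mpoly A[k]}) (lr : k.-tuple {mpoly A[l]}) :
  (p \mPo lq) \mPo lr = p \mPo [tuple tnth lq i \mPo lr | i < n].
Proof.
rewrite (comp_mpolyEX p lq) (comp_mpolyEX p) raddf_sum; apply: eq_bigr => m _.
rewrite /= comp_mpolyZ !comp_mpolyX rmorph_prod; congr (_ *: _).
by apply: eq_bigr => i _; rewrite rmorphXn tnth_mktuple.
Qed.

(** * The parametrization, its kernel and the Groebner basis *)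

Section Parametrization.
Variables (R : realType) (d : nat).
Local Notation C := (complex R).
Local Notation C3 := {mpoly C[3]}.
Implicit Types (m : 'X_{1..d.+1}) (p r : cpoly R d).

Local Notation iX := (inord 0 : 'I_3).
Local Notation iY := (inord 1 : 'I_3).
Local Notation iT := (inord 2 : 'I_3).

(** The parameters are arbitrary polynomials, so that the specializations of [phi] giving the chain
    of primes are also covered. *)
Definition param (t x y : C3) (p : cpoly R d) : C3 :=
  p \mPo [tuple linrec t x y i | i < d.+1].

Lemma paramXU t x y (i : 'I_d.+1) : param t x y 'X_i = linrec t x y i.
Proof. by rewrite /param comp_mpolyXU -tnth_nth tnth_mktuple. Qed.

Lemma paramM t x y : {morph param t x y : p r / p * r}.
Proof. exact: rmorphM. Qed.

Lemma paramD t x y : {morph param t x y : p r / p + r}.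
Proof. exact: rmorphD. Qed.

Lemma param_gens t x y p : gens p -> param t x y p = 0.
Proof.
move=> [a [[|b] [ad // _ bd ->]]].
have uE k : (k <= d)%N -> param t x y (uvar R d k) = linrec t x y k.
  by move=> kd; rewrite paramXU inordK.
rewrite /fyv /param !(rmorphB, rmorphD, rmorphM) /= -!/(param _ _ _ _).
rewrite !uE; try lia.
by rewrite (linrecSS _ _ _ a) (linrecSS _ _ _ b); ring.
Qed.

Lemma param_Iideal t x y p : Iideal p -> param t x y p = 0.
Proof.
move=> [k [c [g [gg ->]]]]; rewrite /param raddf_sum big1 // => i _ /=.
by rewrite rmorphM /= -!/(param _ _ _ _) (param_gens _ _ _ (gg i)) mulr0.
Qed.

Lemma param_prime t x y : is_prime_ideal (fun p => param t x y p = 0).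
Proof.
split; first split.
- by rewrite /param comp_mpoly0.
- by move=> a b pa pb; rewrite paramD pa pb addr0.
- by move=> a b pb; rewrite paramM pb mulr0.
- by rewrite /param comp_mpoly1 => /eqP; rewrite oner_eq0.
- move=> a b /eqP; rewrite paramM mulf_eq0 => /orP[] /eqP; [by left|by right].
Qed.

Lemma param_specialize t x y (lr : 3.-tuple C3) p :
  param (t \mPo lr) (x \mPo lr) (y \mPo lr) p = param t x y p \mPo lr.
Proof.
rewrite /param comp_mpolyA; congr (p \mPo _); apply: eq_from_tnth => i.
rewrite !tnth_mktuple; apply/esym.
exact: (rmorph_linrec (comp_mpoly lr : {rmorphism C3 -> C3})).
Qed.

Local Notation phi := (param 'X_iT 'X_iX 'X_iY).
Local Notation useq := (linrec ('X_iT : C3) 'X_iX 'X_iY).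

(** Monomials are compared by degree first, and multiplication by [t] makes the first term of the
    recurrence exceed the second in degree. *)
Lemma mlead_linrec n :
  useq n.+1 != 0 /\ mlead (useq n.+1) = (U_(iY) + U_(iT) *+ n)%MM.
Proof.
have ltdeg (m m' : 'X_{1..3}) : (mdeg m < mdeg m')%N -> (m < m')%O.
  by move=> lt; rewrite ltNge; apply/negP => /lemc_mdeg; rewrite leqNgt lt.
have X0 (i : 'I_3) : ('X_i : C3) != 0.
  by rewrite -msupp_eq0 msuppX.
have step (m : 'X_{1..3}) (p q : C3) : p != 0 -> mlead p = m ->
    (mdeg (mlead q) <= mdeg m)%N ->
    'X_iT * p + q != 0 /\ mlead ('X_iT * p + q) = (U_(iT) + m)%MM :> 'X_{1..3}.
  move=> p0 pm qm.
  have pE : mlead ('X_iT * p) = (U_(iT) + m)%MM by rewrite mleadM // mleadXm pm.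
  have lt : (mlead q < mlead ('X_iT * p))%O.
    by apply: ltdeg; rewrite pE mdegD mdeg1 add1n ltnS.
  have E := mleadDl lt; split; last by rewrite E.
  apply/eqP => e0; move: E; rewrite e0 mlead0 pE => /(congr1 mdeg).
  by rewrite mdeg0 mdegD mdeg1.
have [l] := ubnP n; elim: l n => // l IH [|[|n]] lenl.
- by rewrite ?linrec0 ?linrec1 mulm0n addm0 mleadXm.
- rewrite (linrecSS _ _ _ 0).
  have [|||nz ->] := step U_(iY)%MM (useq 1) (useq 0).
  + by rewrite linrec1.
  + by rewrite ?linrec0 ?linrec1 mleadXm.
  + by rewrite ?linrec0 ?linrec1 mleadXm !mdeg1.
  by split=> //; rewrite mulm1n addmC.
have [nz1 E1] := IH n.+1 ltac:(lia); have [_ E0] := IH n ltac:(lia).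
rewrite (linrecSS _ _ _ n.+1).
have [|nz ->] := step _ (useq n.+2) (useq n.+1) nz1 E1.
  by rewrite E0 !mdegD !mdegMn !mdeg1; lia.
split=> //; apply/mnmP => k; rewrite !mnmDE !mulmnE; lia.
Qed.

Lemma linrec_neq0 n : useq n != 0.
Proof.
case: n => [|n]; first by rewrite linrec0 -msupp_eq0 msuppX.
by have [] := mlead_linrec n.
Qed.

Definition lead_exp m : 'X_{1..3} := mlead (phi 'X_[m]).

Lemma phiX_neq0 m : phi 'X_[m] != 0.
Proof.
rewrite /param comp_mpolyX prodf_seq_neq0; apply/allP => i _ /=.
by rewrite tnth_mktuple expf_neq0 // linrec_neq0.
Qed.

(** Leading monomials multiply: [u_0] contributes [x] and [u_k] contributes [y t^(k-1)] for positive
    [k]. The convention [0.-1 = 0] makes the last sum ignore [u_0]. *)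
Lemma lead_expE m :
  [/\ lead_exp m iX = m ord0,
      lead_exp m iY = (\sum_(k < d.+1) (0 < k) * m k)%N
    & lead_exp m iT = (\sum_(k < d.+1) k.-1 * m k)%N].
Proof.
have E : lead_exp m = (\sum_(k < d.+1) mlead (useq k) *+ m k)%MM.
  rewrite /lead_exp /param comp_mpolyX mlead_prod => [|i _ _].
    by apply: eq_bigr => i _; rewrite tnth_mktuple mleadX ?linrec_neq0.
  by rewrite tnth_mktuple expf_neq0 ?linrec_neq0.
have lin (j : 'I_3) n : mlead (useq n) j =
    if n is n'.+1 then ((j == iY) + (j == iT) * n')%N else (j == iX) :> nat.
  case: n => [|n]; first by rewrite ?linrec0 ?linrec1 mleadXm mnm1E eq_sym.
  by have [_ ->] := mlead_linrec n; rewrite mnmDE mulmnE !mnm1E !(eq_sym j).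
have ne (a b : nat) : (a < 3)%N -> (b < 3)%N -> ((inord a : 'I_3) == inord b) = (a == b).
  by move=> a3 b3; rewrite -val_eqE /= !inordK.
rewrite E; split; rewrite mnm_sumE.
- rewrite (bigD1 ord0) //= mulmnE lin eqxx mul1n big1 ?addn0 // => k.
  rewrite -val_eqE /= mulmnE lin; case: (nat_of_ord k) => // n _.
  by rewrite !ne.
- apply: eq_bigr => k _; rewrite mulmnE lin; congr muln.
  by case: (nat_of_ord k) => [|n]; rewrite !ne.
- apply: eq_bigr => k _; rewrite mulmnE lin; congr muln.
  by case: (nat_of_ord k) => [|n]; rewrite !ne ?mul1n.
Qed.

Lemma mweight_split m : (Defs.mweight m
  = \sum_(k < d.+1) k.-1 * m k + \sum_(k < d.+1) (0 < k) * m k)%N.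
Proof.
rewrite -big_split; apply: eq_bigr => k _ /=.
by case: (nat_of_ord k) => //= l; rewrite mul1n mulSn addnC.
Qed.

(** The [y] exponent is the degree in the variables of positive index, and adding the [t] exponent
    gives the weight. By [standard_expE] these two determine all exponents but that of [u_0], which
    is the [x] exponent. *)
Lemma lead_exp_inj m m' :
  standard m -> standard m' -> lead_exp m = lead_exp m' -> m = m'.
Proof.
move=> sm sm' e; have [e0 e1 e2] := lead_expE m; have [f0 f1 f2] := lead_expE m'.
rewrite e in e0 e1 e2.
apply/mnmP => k; case: (posnP k) => [k0|k0].
  by have -> : k = ord0 by [apply: val_inj]; rewrite -e0.
by rewrite (standard_expE sm k0) (standard_expE sm' k0) !mweight_split -e1 -e2 -f1 -f2.
Qed.

(** The largest leading monomial among the images is attained by a single monomial of [r], so it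
    cannot cancel. *)
Lemma phi_standard_inj r :
  (forall m, m \in msupp r -> standard m) -> phi r = 0 -> r = 0.
Proof.
move=> std_r phi0; apply/eqP; rewrite -msupp_eq0; apply: contraT => supp0.
have [m mr mmax] : exists2 m, m \in msupp r &
    forall m', m' \in msupp r -> (lead_exp m' <= lead_exp m)%O.
  exact: seq_argmax.
have : (phi r)@_(lead_exp m) = r@_m * (phi 'X_[m])@_(lead_exp m).
  rewrite /param (comp_mpolyEX r) (bigD1_seq m) ?msupp_uniq //= -!/(param _ _ _ _).
  rewrite mcoeffD mcoeffZ -[RHS]addr0; congr (_ + _).
  rewrite (raddf_sum (mcoeff (lead_exp m))) /= big_seq_cond.
  apply: big1 => m' /andP[m'r nem]; rewrite mcoeffZ [X in _ * X]mcoeff_gt_mlead ?mulr0 //.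
  rewrite -/(param _ _ _ _) -/(lead_exp m') lt_neqAle mmax // andbT.
  apply: contra nem => /eqP e; apply/eqP.
  exact: lead_exp_inj (std_r _ m'r) (std_r _ mr) e.
rewrite phi0 mcoeff0 => /esym/eqP; rewrite mulf_eq0 mleadc_eq0.
by rewrite (negbTE (phiX_neq0 m)) orbF mcoeff_eq0 mr.
Qed.

(** If [phi p = 0], a standard remainder of [p] also has image 0, hence is 0. *)
Lemma IidealE p : Iideal p <-> phi p = 0.
Proof.
split; first exact: param_Iideal.
move=> phip; have [r [Ir Hr]] := poly_reduces p.
have phir : phi r = 0.
  have := param_Iideal 'X_iT 'X_iX 'X_iY Ir.
  rewrite /param rmorphB /= -!/(param _ _ _ _) phip sub0r => /eqP.
  by rewrite oppr_eq0 => /eqP.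
have r0 : r = 0 by apply: phi_standard_inj phir => m /Hr[].
by move: Ir; rewrite r0 subr0.
Qed.

Lemma Iideal_prime : is_prime_ideal (@Iideal R d).
Proof.
have [[P0 PD PM] P1 PP] := param_prime 'X_iT 'X_iX 'X_iY.
split; first split.
- exact/IidealE.
- by move=> a b /IidealE Pa /IidealE Pb; apply/IidealE/PD.
- by move=> a b /IidealE Pb; apply/IidealE/PM.
- by move=> /IidealE.
- by move=> a b /IidealE/PP[] /IidealE; [left|right].
Qed.

Lemma gens_groebner : groebner_basis (@gens R d) (@Iideal R d).
Proof.
split=> [p|f If f0 m [mf mlm]]; first exact: ideal_gen_sub.
have [std_m|/standardPn[a [c [m0 [a0 ac mE]]]]] := boolP (standard m); last first.
  have [y yE] : exists y, y.+1 = a :> nat by exists a.-1; lia.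
  have [v vE] : exists v, v.+1 = c :> nat by exists c.-1; lia.
  have vd : (v < d)%N by have := ltn_ord c; lia.
  have aE : a = inord y.+1 by apply: val_inj; rewrite /= inordK //; lia.
  have cE : c = inord v.+1 by apply: val_inj; rewrite /= inordK //; lia.
  have lm := @fyv_lm R d y v ltac:(lia).
  rewrite mE -addmA mpolyXD; set S := fun q => exists g m', _.
  have [_ _ IM] := ideal_gen_ideal S; apply: IM; apply: ideal_gen_sub.
  exists (fyv R d y v), (U_(a) + U_(c))%MM.
  split=> //; last by rewrite aE cE.
    by exists y, v; split=> //; lia.
  by case: lm => lm _; apply: contraTneq lm => ->; rewrite msupp0.
(* A standard leading monomial is impossible: reducing the tail [q] to [r] gives a standard
   polynomial [f@_m *: 'X_[m] + r] in the kernel of [phi], hence 0, although [m] does not occur in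
   [r]. *)
exfalso; pose q := f - f@_m *: 'X_[m].
have qm (m' : 'X_{1..d.+1}) : m' \in msupp q -> term_gt m m'.
  move=> m'q; have ne : m' <> m.
    move=> e; move: m'q.
    by rewrite mcoeff_msupp e mcoeffB mcoeffZ mcoeffX eqxx mulr1 subrr eqxx.
  apply: mlm => //; move: m'q; rewrite !mcoeff_msupp mcoeffB mcoeffZ mcoeffX.
  by rewrite [m == m']eq_sym (introF eqP ne) mulr0 subr0.
have [r [Ir Hr]] := poly_reduces q.
have r0 : f@_m *: 'X_[m] + r = 0.
  apply: phi_standard_inj => [m'|].
    move=> /msuppD_le; rewrite mem_cat => /orP[/msuppZ_le|/Hr[]//].
    by rewrite msuppX inE => /eqP->.
  have /IidealE := Ir; have /IidealE := If; rewrite /q /param.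
  rewrite !raddfB raddfD /= => ->; rewrite sub0r => /eqP.
  by rewrite -opprD oppr_eq0 => /eqP.
have mr : m \notin msupp r.
  apply/negP => /Hr[_ [m' /qm mm' [e|m'm]]].
    by move: mm'; rewrite -e (negbTE (term_gt_irr m)).
  by have := term_gt_trans mm' m'm; rewrite (negbTE (term_gt_irr m)).
have := congr1 (mcoeff m) r0; rewrite mcoeffD mcoeffZ mcoeffX eqxx mulr1 mcoeff0.
by rewrite (memN_msupp_eq0 mr) addr0 => /eqP; rewrite mcoeff_eq0 mf.
Qed.

End Parametrization.

(** * Polynomials vanishing at all natural points *)

Lemma base_expansion_inj (K n : nat) (a b : 'I_n -> nat) :
  (forall i, a i < K)%N -> (forall i, b i < K)%N ->
  (\sum_(i < n) a i * K ^ i = \sum_(i < n) b i * K ^ i)%N -> a =1 b.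
Proof.
elim: n a b => [|n IH] a b aK bK; first by move=> _ [].
have shift (c : 'I_n.+1 -> nat) : (\sum_(i < n.+1) c i * K ^ i
    = (\sum_(i < n) c (lift ord0 i) * K ^ i) * K + c ord0)%N.
  rewrite big_ord_recl muln1 addnC; congr addn; rewrite big_distrl /=.
  by apply: eq_bigr => i _; rewrite expnSr mulnA.
rewrite !shift => e; have K0 : (0 < K)%N by case: (K) (aK ord0).
have e0 : a ord0 = b ord0.
  by have := congr1 (modn^~ K) e; rewrite !modnMDl !modn_small.
have eS : (fun i => a (lift ord0 i)) =1 (fun i => b (lift ord0 i)).
  apply: IH => //; apply/eqP.
  by move/eqP: e; rewrite e0 eqn_add2r eqn_pmul2r.
by move=> i; case: (unliftP ord0 i) => [j ->|->] //; apply: eS.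
Qed.

Lemma poly_nat_eq0 (A : numDomainType) (q : {poly A}) :
  (forall x : nat, q.[x%:R] = 0) -> q = 0.
Proof.
move=> q0; apply/eqP; apply: contraT => nz.
have := @max_poly_roots A q [seq x%:R | x <- iota 0 (size q)] nz.
rewrite size_map size_iota ltnn; apply.
  by apply/allP => _ /mapP[x _ ->]; rewrite /root q0.
rewrite map_inj_uniq ?iota_uniq // => x y /eqP.
by rewrite eqr_nat => /eqP.
Qed.

(* Kronecker substitution [x_i = x ^ (K ^ i)] reduces to one variable. *)
Lemma mpoly_nat_eq0 (A : numDomainType) (n : nat) (q : {mpoly A[n]}) :
  (forall v : 'I_n -> nat, q.@[fun i => (v i)%:R] = 0) -> q = 0.
Proof.
(* [K] exceeds every exponent in [q], so [kron] is injective on its monomials. *)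
move=> q0; pose K := msize q.
pose kron (m : 'X_{1..n}) := (\sum_(i < n) m i * K ^ i)%N.
have mK (m : 'X_{1..n}) (i : 'I_n) : m \in msupp q -> (m i < K)%N.
  move=> mq; apply: leq_ltn_trans (msize_mdeg_lt mq).
  by rewrite mdegE (bigD1 i) //= leq_addr.
have kq0 : \sum_(m <- msupp q) q@_m *: 'X^(kron m) = 0 :> {poly A}.
  apply: poly_nat_eq0 => x; rewrite -[RHS](q0 (fun i => x ^ (K ^ i))%N).
  rewrite horner_sum mevalE; apply: eq_bigr => m _.
  rewrite hornerZ hornerXn; congr (_ * _); rewrite /kron -prodrXr.
  by apply: eq_bigr => i _; rewrite natrX -exprM mulnC.
apply/eqP; rewrite -msupp_eq0; apply: contraT => /seq_argmax-/(_ _ _ mdeg)[m mq _].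
have := congr1 (fun p : {poly A} => p`_(kron m)) kq0.
rewrite coef0 coef_sum (bigD1_seq m) ?msupp_uniq //= coefZ coefXn eqxx mulr1.
rewrite big_seq_cond big1 ?addr0 => [/eqP|m' /andP[m'q nem]].
  by rewrite mcoeff_eq0 mq.
rewrite coefZ coefXn; case: eqP => [e|]; last by rewrite mulr0.
case/eqP: nem; apply/mnmP => i; symmetry.
by apply: (@base_expansion_inj K n m m') => // j; apply: mK.
Qed.

(** * Odeco tensors and solutions of the recurrence *)

Section Odeco.
Variables (R : realType) (d : nat).
Local Notation C := (complex R).
Implicit Types (p : cpoly R d).

Lemma vanishing_zariski_closure (X : point R d -> Prop) p :
  vanishing_ideal (zariski_closure X) p <-> vanishing_ideal X p.
Proof. by split=> [v u Xu|v u]; [apply: v => q; apply | apply]. Qed.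

Lemma gens_vanish_odeco p : gens p -> vanishing_ideal (@odeco R d) p.
Proof.
move=> [y [[|v] [yd // _ vd ->]]] u [l1 [l2 [a [b [c [e [_ _ ortho ->]]]]]]].
have {}ortho : a%:C%C * c%:C%C + b%:C%C * e%:C%C = 0 :> C.
  by rewrite -!rmorphM -rmorphD ortho.
move: (a%:C)%C (b%:C)%C (c%:C)%C (e%:C)%C (l1%:C)%C (l2%:C)%C ortho.
move=> {l1 l2 a b c e} a b c e l1 l2 ortho.
(* Naming the smallest exponents [n] and [k] removes the truncated subtractions, so that [ring]
   applies. *)
have [n nE] : exists n, d = (n + y.+2)%N by exists (d - y.+2)%N; lia.
have [k kE] : exists k, d = (k + v.+2)%N by exists (d - v.+2)%N; lia.
have uE j : (j <= d)%N -> (uvar R d j).@[coords l1 l2 (a, b) (c, e)] =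
    (d`!)%:R * (l1 * a ^+ j * b ^+ (d - j) + l2 * c ^+ j * e ^+ (d - j)).
  by move=> jd; rewrite mevalXU /coords inordK.
rewrite /fyv !(mevalB, mevalD, mevalM) !uE; try lia.
have -> : (d - y.+2 = n)%N by lia.
have -> : (d - y.+1 = n.+1)%N by lia.
have -> : (d - y = n.+2)%N by lia.
have -> : (d - v.+2 = k)%N by lia.
have -> : (d - v.+1 = k.+1)%N by lia.
have -> : (d - v.+1.-1 = k.+2)%N by lia.
rewrite /= !exprS.
set F := (d`!)%:R.
(* The terms in [l1 ^+ 2] and [l2 ^+ 2] cancel, and the mixed ones contain the scalar product of the
   two vectors as a factor. *)
transitivity (F ^+ 2 * l1 * l2 * (a ^+ y * b ^+ n * c ^+ v * e ^+ k
   - a ^+ v * b ^+ k * c ^+ y * e ^+ n) * (b * c - a * e) * (a * c + b * e)).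
  by rewrite expr2; ring.
by rewrite ortho mulr0.
Qed.

Lemma linrec_odeco (t x y : R) : (1 <= d)%N ->
  exists2 u, @odeco R d u &
    forall i : 'I_d.+1, u i = linrec (t%:C)%C (x%:C)%C (y%:C)%C i.
Proof.
move=> d1.
have [r r2] : exists r : R, r ^+ 2 = t * r + 1.
  exists ((t + Num.sqrt (t ^+ 2 + 4)) / 2).
  have := @sqr_sqrtr R (t ^+ 2 + 4) ltac:(nra).
  by move: (Num.sqrt _) => s s2; field : s2.
have r0 : r != 0.
  apply/eqP => e; move: r2; rewrite e expr0n mulr0 add0r => /eqP.
  by rewrite eq_sym oner_eq0.
have n0 : 0 < r ^+ 2 + 1 by rewrite ltr_wpDl // sqr_ge0.
pose n := Num.sqrt (r ^+ 2 + 1).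
have n2 : n ^+ 2 = r ^+ 2 + 1 by rewrite sqr_sqrtr // ltW.
have nn0 : n != 0 by rewrite gt_eqF // sqrtr_gt0.
have K0 : r ^+ d.-1 != 0 by rewrite expf_neq0.
have F0 : (d`!)%:R != 0 :> R by rewrite pnatr_eq0 -lt0n fact_gt0.
(* [L1] and [L2] solve [U 0 = x] and [U 1 = y]. The second term of [U] is a multiple of the power
   [k] of the other root [-1/r], with [r ^+ d] absorbed in [L2]. *)
pose L1 := (x + r * y) / (r ^+ 2 + 1).
pose L2 := (r * x - y) / (r ^+ d.-1 * (r ^+ 2 + 1)).
pose U k := L1 * r ^+ k + L2 * (-1) ^+ k * r ^+ (d - k).
have dE : d = d.-1.+1 by lia.
have nz : r ^+ 2 + 1 != 0 by rewrite gt_eqF.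
have U0 : U 0%N = x.
  rewrite /U subn0 [in r ^+ d]dE exprS !expr0 /L1 /L2.
  by field; rewrite nz K0.
have U1 : U 1%N = y.
  rewrite /U subn1 !expr1 /L1 /L2.
  by field; rewrite nz K0.
have USS k : (k.+2 <= d)%N -> U k.+2 = t * U k.+1 + U k.
  move=> kd; have [l lE] : exists l, d = (l + k.+2)%N by exists (d - k.+2)%N; lia.
  rewrite /U.
  have -> : (d - k.+2 = l)%N by lia.
  have -> : (d - k.+1 = l.+1)%N by lia.
  have -> : (d - k = l.+2)%N by lia.
  have e1 : r ^+ k.+2 = (t * r + 1) * r ^+ k by rewrite -r2 -exprD.
  have e2 : r ^+ l.+2 = (t * r + 1) * r ^+ l by rewrite -r2 -exprD.
  by rewrite e1 e2 !exprS; ring.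
have {}USS k : (k <= d)%N -> U k = linrec t x y k.
  by move=> kd; rewrite (linrec_uniq USS) // U0 U1.
(* This factor compensates the normalization of [(r, 1)] and [(-1, r)] to unit vectors and the
   factorial in [coords]. *)
pose s := n ^+ d / (d`!)%:R.
exists (coords ((s * L1)%:C)%C ((s * L2)%:C)%C (((r / n)%:C)%C, ((1 / n)%:C)%C)
  (((- 1 / n)%:C)%C, ((r / n)%:C)%C)).
  exists (s * L1), (s * L2), (r / n), (1 / n), (- 1 / n), (r / n); split=> //.
  - by rewrite !expr_div_n n2 expr1n -mulrDl divff.
  - by rewrite !expr_div_n n2 sqrrN expr1n -mulrDl addrC divff.
  - by field.
move=> i; rewrite -(rmorph_linrec (real_complex R)) -USS; last by rewrite -ltnS.
rewrite /coords /=.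
have -> : ((d`!)%:R : C) = (((d`!)%:R : R)%:C)%C by rewrite rmorph_nat.
rewrite -!rmorphXn -!rmorphM -rmorphD -rmorphM /=; congr (_%:C)%C.
have nE : n ^+ d = n ^+ i * n ^+ (d - i) by rewrite -exprD subnKC // -ltnS.
rewrite /U /s nE !expr_div_n expr1n.
by field; rewrite F0 !expf_neq0.
Qed.

End Odeco.

(** * The ideal of the odeco variety *)

Section VanishingIdeal.
Variables (R : realType) (d : nat).
Local Notation C := (complex R).
Local Notation phi := (@param R d 'X_(inord 2) 'X_(inord 0) 'X_(inord 1)).
Implicit Types (p : cpoly R d).

(** Natural values of [x], [y], [t] are real, so they give odeco tensors, and they suffice to show
    that [phi p] is 0. *)
Lemma vanishing_odeco_phi p :
  (1 <= d)%N -> vanishing_ideal (@odeco R d) p -> phi p = 0.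
Proof.
move=> d1 pv; apply: mpoly_nat_eq0 => v; pose w := fun i => (v i)%:R : C.
have [u uo uE] := @linrec_odeco R d (v (inord 2))%:R (v (inord 0))%:R
  (v (inord 1))%:R d1.
rewrite -(pv u uo) /param comp_mpoly_meval; apply: meval_eq => i.
rewrite tnth_mktuple (rmorph_linrec (meval w : {rmorphism {mpoly C[3]} -> C})).
by rewrite uE /= !rmorph_nat !mevalXU.
Qed.

Lemma Iideal_vanishing p : (1 <= d)%N ->
  Iideal p <-> vanishing_ideal (@odeco_variety R d) p.
Proof.
move=> d1; rewrite /odeco_variety vanishing_zariski_closure; split; last first.
  by move=> /(vanishing_odeco_phi d1)/IidealE.
move=> [k [c [g [gg ->]]]] u ou; rewrite raddf_sum big1 // => i _ /=.
by rewrite mevalM (gens_vanish_odeco (gg i) ou) mulr0.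
Qed.

End VanishingIdeal.

(** * Dimension: counting monomials and chains of primes *)

Lemma card_bmultinom_le (n b : nat) : (#|{: 'X_{1..n < b}}| <= b ^ n)%N.
Proof.
case: b => [|b]; first by rewrite eq_card0 // => -[m].
pose f (m : 'X_{1..n < b.+1}) : {ffun 'I_n -> 'I_b.+1} := [ffun i => inord (bmnm m i)].
have le (m : 'X_{1..n < b.+1}) i : (bmnm m i < b.+1)%N.
  apply: leq_ltn_trans (bmdeg m).
  by rewrite mdegE (bigD1 i) //= leq_addr.
have /leq_card : injective f.
  move=> m1 m2 /ffunP e; apply/val_inj/mnmP => i.
  by have /(congr1 val) := e i; rewrite !ffunE /= !inordK ?le.
by rewrite card_ffun !card_ord.
Qed.

(** The coefficient matrix has more rows than columns; a nonzero row of its kernel gives the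
    relation. *)
Lemma mpoly_dependent (F : fieldType) (n M : nat) (J : finType)
    (h : J -> {mpoly F[n]}) :
  (forall j, msize (h j) <= M)%N -> (M ^ n < #|J|)%N ->
  exists c : J -> F, (exists j, c j != 0) /\ \sum_j c j *: h j = 0.
Proof.
move=> hM cardJ; pose B : finType := 'X_{1..n < M}.
pose A : 'M[F]_(#|J|, #|B|) :=
  \matrix_(i, k) (h (enum_val i))@_(bmnm (enum_val k)).
have : kermx A != 0.
  rewrite kermx_eq0 /row_free neq_ltn; apply/orP; left.
  apply: leq_ltn_trans (rank_leq_col A) _.
  exact: leq_ltn_trans (card_bmultinom_le n M) cardJ.
case/matrix0Pn => i0 [j0 nz].
exists (fun j => kermx A i0 (enum_rank j)); split.
  by exists (enum_val j0); rewrite enum_valK.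
apply/mpolyP => m; rewrite mcoeff0 raddf_sum /=.
have [mM|Mm] := ltnP (mdeg m) M; last first.
  apply: big1 => j _; rewrite mcoeffZ (memN_msupp_eq0 _) ?mulr0 //.
  exact: msize_mdeg_ge (leq_trans (hM j) Mm).
have /matrixP/(_ i0 (enum_rank (BMultinom mM : B))) := mulmx_ker A.
rewrite [LHS]mxE [RHS]mxE; apply: etrans.
rewrite (reindex (fun k : 'I_#|J| => enum_val k)) /=; last first.
  by exists enum_rank => j _; rewrite ?enum_rankK ?enum_valK.
apply: eq_bigr => k _.
by rewrite mcoeffZ enum_valK [A _ _]mxE enum_rankK.
Qed.

Section Dimension.
Variables (R : realType) (d : nat).
Local Notation C := (complex R).
Local Notation phi := (@param R d 'X_(inord 2) 'X_(inord 0) 'X_(inord 1)).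
Implicit Types (p f : cpoly R d) (P Q : cpoly R d -> Prop).

Definition independent_mod P (J : finType) (b : J -> cpoly R d) :=
  forall c : J -> C, P (\sum_j c j *: b j) -> forall j, c j = 0.

(** Modulo [Q] only [B 0] survives, so it is 0; primality of [P] then allows division by [f], and
    the argument repeats. *)
Lemma power_coefs_eq0 P Q f N (B : nat -> cpoly R d) :
  is_prime_ideal P -> is_ideal Q -> (forall p, P p -> Q p) -> Q f -> ~ P f ->
  (forall i, Q (B i) -> B i = 0) -> P (\sum_(i < N) B i * f ^+ i) ->
  forall i, (i < N)%N -> B i = 0.
Proof.
move=> [_ _ PP] [Q0 QD QM] PQ Qf nPf; elim: N B => // N IH B QB.
have -> : \sum_(i < N.+1) B i * f ^+ i = B 0%N + f * \sum_(i < N) B i.+1 * f ^+ i.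
  rewrite big_ord_recl expr0 mulr1 mulr_sumr; congr (_ + _).
  by apply: eq_bigr => i _; rewrite /= exprS; ring.
set S := \sum_(i < N) _ => PS.
have B0 : B 0%N = 0.
  apply: QB; have -> : B 0%N = (B 0%N + f * S) + (- S) * f by ring.
  by apply: QD; [exact: PQ | exact: QM].
move: PS; rewrite B0 add0r => /PP[//|PS] [|i] // iN.
exact: (IH (fun i => B i.+1) (fun i => QB i.+1) PS i iN).
Qed.

Lemma independent_mod_powers P Q f N (J : finType) (b : J -> cpoly R d) :
  is_prime_ideal P -> is_ideal Q -> (forall p, P p -> Q p) -> Q f -> ~ P f ->
  independent_mod Q b ->
  independent_mod P (fun ji : J * 'I_N => b ji.1 * f ^+ ji.2).
Proof.
move=> prP idQ PQ Qf nPf indb c Pc [j i].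
(* The coefficients are extended by 0 to all natural exponents, as [power_coefs_eq0] expects. *)
pose cc k l := if insub k is Some k' then c (l, k') else 0.
pose B k := \sum_l cc k l *: b l.
have ccE (k : 'I_N) l : cc k l = c (l, k) by rewrite /cc valK.
have QB k : Q (B k) -> B k = 0.
  by move=> /indb z; apply: big1 => l _; rewrite z scale0r.
have {}Pc : P (\sum_(k < N) B k * f ^+ k).
  move: Pc; congr P.
  transitivity (\sum_(p : J * 'I_N) c (p.1, p.2) *: (b p.1 * f ^+ p.2)).
    by apply: eq_bigr => -[].
  rewrite -(pair_bigA _ (fun l k => c (l, k) *: (b l * f ^+ k))) /=.
  rewrite exchange_big /=; apply: eq_bigr => k _; rewrite /B mulr_suml.
  by apply: eq_bigr => l _; rewrite ccE scalerAl.
have Bi := power_coefs_eq0 prP idQ PQ Qf nPf QB Pc (ltn_ord i).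
rewrite -ccE; apply: (indb (cc i)); rewrite -/(B i) Bi.
by case: idQ.
Qed.

Lemma msize_mulX_le (A : idomainType) n (p q : {mpoly A[n]}) D E N i :
  (msize p <= D.+1)%N -> (msize q <= E.+1)%N -> (i <= N)%N ->
  (msize (p * q ^+ i) <= (D + N * E).+1)%N.
Proof.
move=> pD qE iN; apply: (@leq_trans (D + i * E).+1); last first.
  by rewrite ltnS leq_add2l leq_mul2r iN orbT.
elim: i {iN} => [|i IH]; first by rewrite expr0 mulr1 mul0n addn0.
rewrite exprSr mulrA; have [->|nz] := eqVneq (p * q ^+ i) 0.
  by rewrite mul0r msize0.
have [->|nzq] := eqVneq q 0; first by rewrite mulr0 msize0.
by rewrite msizeM // mulSn; lia.
Qed.

(** Going down from the constant 1 modulo the top prime, four steps give [N ^ 4] products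
    independent modulo the bottom one. Their images have degree at most [4 * N * E] in three
    variables, too few monomials for large [N]. *)
Lemma no_prime_chain4 : ~ prime_chain (@Iideal R d) 4.
Proof.
move=> [P [prP IP chain]].
have idP i : is_ideal (P i) by case: (prP i).
have [fs fsP] : exists fs : 'I_4 -> cpoly R d, forall i : 'I_4,
    P (lift ord0 i) (fs i) /\ ~ P (widen_ord (leqnSn 4) i) (fs i).
  apply: (@fin_all_exists _ _ (fun (i : 'I_4) f => 
    P (lift ord0 i) f /\ ~ P (widen_ord (leqnSn 4) i) f)) => i.
  by have [|_ [f fP]] := chain (widen_ord (leqnSn 4) i) (lift ord0 i); last exists f.
have sub (i : 'I_4) p : P (widen_ord (leqnSn 4) i) p -> P (lift ord0 i) p.
  by have [//|H _] := chain (widen_ord (leqnSn 4) i) (lift ord0 i); apply: H.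
pose E := (\max_(i < 4) msize (phi (fs i)))%N.
have fsE i : (msize (phi (fs i)) <= E.+1)%N.
  by apply: leqW; rewrite /E (bigD1 i) //= leq_maxl.
(* Chosen so that [(4 * N * E + 1) ^ 3 <= N ^ 3 * (4 * E + 1) ^ 3 < N ^ 4]. *)
pose N := ((4 * E).+1 ^ 3).+1.
have step (i : 'I_4) (J : finType) (b : J -> cpoly R d) D :
    independent_mod (P (lift ord0 i)) b ->
    (forall j, msize (phi (b j)) <= D.+1)%N ->
  exists b' : J * 'I_N -> cpoly R d,
    independent_mod (P (widen_ord (leqnSn 4) i)) b' /\
    (forall j, msize (phi (b' j)) <= (D + N * E).+1)%N.
  move=> indb bD; exists (fun ji : J * 'I_N => b ji.1 * fs i ^+ ji.2); split.
    have [Qf nPf] := fsP i.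
    exact: independent_mod_powers (prP _) (idP _) (sub i) Qf nPf indb.
  move=> [j k]; rewrite paramM /param rmorphXn /= -!/(param _ _ _ _).
  exact: msize_mulX_le (bD j) (fsE i) (ltnW (ltn_ord k)).
have reindex (a : 'I_4) (b : 'I_4) : b = a.+1 :> nat ->
    P (lift ord0 a) = P (widen_ord (leqnSn 4) b).
  by move=> e; congr P; apply: val_inj; rewrite /= e.
pose i3 : 'I_4 := @Ordinal 4 3 isT; pose i2 : 'I_4 := @Ordinal 4 2 isT.
pose i1 : 'I_4 := @Ordinal 4 1 isT; pose i0 : 'I_4 := @Ordinal 4 0 isT.
have ind4 : independent_mod (P (lift ord0 i3)) (fun _ : unit => 1).
  move=> c; rewrite (big_pred1 tt) => [Pc [] | []//].
  have [_ n1 _] := prP (lift ord0 i3); have [_ _ PM] := idP (lift ord0 i3).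
  apply/eqP; apply: contra_notT n1 => nz.
  have := PM ((c tt)^-1)%:MP _ Pc.
  by rewrite mul_mpolyC scalerA mulVf // scale1r.
have [|b3 [ind3 s3]] := step i3 _ _ 0%N ind4.
  by move=> _; rewrite /param comp_mpoly1 msize1.
rewrite -(reindex i2 i3 erefl) in ind3; have [b2 [ind2 s2]] := step i2 _ _ _ ind3 s3.
rewrite -(reindex i1 i2 erefl) in ind2; have [b1 [ind1 s1]] := step i1 _ _ _ ind2 s2.
rewrite -(reindex i0 i1 erefl) in ind1; have [b0 [ind0 s0]] := step i0 _ _ _ ind1 s1.
have [|c [[j /eqP nz] cb]] := mpoly_dependent s0.
  rewrite !card_prod card_unit !card_ord mul1n add0n.
  have le : ((N * E + N * E + N * E + N * E).+1 <= N * (4 * E).+1)%N by nia.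
  rewrite -(leq_exp2r _ _ (isT : 0 < 3)%N) in le; apply: leq_ltn_trans le _.
  rewrite expnMn -[(N * N * N * N)%N](_ : N ^ 3 * N = _)%N ?ltn_pmul2l //.
  by rewrite 2!expnSr expn1.
(* A relation between the images is a combination in the kernel of [phi], that is in the ideal,
   hence in the bottom prime. *)
apply: nz; apply: (ind0 c).
have -> : widen_ord (leqnSn 4) i0 = ord0 by apply: val_inj.
apply/IP/IidealE; rewrite /param raddf_sum /= -[RHS]cb; apply: eq_bigr => k _.
by rewrite comp_mpolyZ.
Qed.

Lemma prime_chain_steps (J : cpoly R d -> Prop) n (P : nat -> cpoly R d -> Prop) :
  (forall i, is_prime_ideal (P i)) -> (forall p, J p -> P 0%N p) ->
  (forall i p, P i p -> P i.+1 p) ->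
  (forall i, (i < n)%N -> exists2 p, P i.+1 p & ~ P i p) ->
  prime_chain J n.
Proof.
move=> prP JP subS strict.
have sub i j p : (i <= j)%N -> P i p -> P j p.
  by move=> /subnK <-; elim: (j - i)%N => // k IH /IH/subS.
exists (fun i : 'I_n.+1 => P i); split=> // i j ij.
split=> [p|]; first exact/sub/ltnW.
have [|p Pp nPp] := strict i; first by have := ltn_ord j; lia.
by exists p; split=> //; apply: sub Pp.
Qed.

Lemma prime_chain3 : (2 <= d)%N -> prime_chain (@Iideal R d) 3.
Proof.
move=> d2; pose X : {mpoly C[3]} := 'X_(inord 0); pose Y : {mpoly C[3]} := 'X_(inord 1).
pose T : {mpoly C[3]} := 'X_(inord 2).
have X0 (i : 'I_3) : ('X_i : {mpoly C[3]}) != 0 by rewrite -msupp_eq0 msuppX.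
(* [x], [t], [y] are killed in this order; [y] comes last because the recurrence no longer depends
   on [t] once [x] and [y] are 0. *)
pose Pn (n : nat) : cpoly R d -> Prop := fun p =>
  param (if (n < 2)%N then T else 0) (if (n < 1)%N then X else 0)
    (if (n < 3)%N then Y else 0) p = 0.
have paramU t x y k : (k <= 2)%N -> param t x y (uvar R d k) = linrec t x y k.
  by move=> k2; rewrite paramXU inordK //; lia.
pose kill (k : 'I_3) : 3.-tuple {mpoly C[3]} :=
  [tuple if i == k then 0 else 'X_i | i < 3].
have killX (i k : 'I_3) : 'X_i \mPo kill k = if i == k then 0 else 'X_i.
  by rewrite comp_mpolyXU -tnth_nth tnth_mktuple.
have ne (a b : nat) : (a < 3)%N -> (b < 3)%N ->
    ((inord a : 'I_3) == inord b) = (a == b).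
  by move=> a3 b3; rewrite -val_eqE /= !inordK.
have specialize k t x y p : param t x y p = 0 ->
    param (t \mPo kill k) (x \mPo kill k) (y \mPo kill k) p = 0.
  by move=> p0; rewrite param_specialize p0 comp_mpoly0.
have subS n p : Pn n p -> Pn n.+1 p.
  rewrite /Pn; case: n => [|[|[|n]]] /=.
  - by move/(specialize (inord 0)); rewrite !killX !ne.
  - by move/(specialize (inord 2)); rewrite comp_mpoly0 !killX !ne.
  - by move/(specialize (inord 1)); rewrite !comp_mpoly0 killX ne.
  - exact: id.
apply: (@prime_chain_steps _ 3 Pn) => [i|p|//|].
- exact: param_prime.
- by move/IidealE.
rewrite /Pn; case=> [|[|[|//]]] _ /=.
(* The separating elements [u_0], [u_2], [u_1] have images [x], then [t y] once [x] is 0, then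
   [y]. *)
- exists (uvar R d 0); rewrite paramU // linrec0; first by [].
  by apply/eqP/X0.
- exists (uvar R d 2); rewrite paramU // (linrecSS _ _ _ 0) linrec1 linrec0 addr0.
    exact: mul0r.
  by apply/eqP; rewrite mulf_neq0 ?X0.
- exists (uvar R d 1); rewrite paramU // linrec1; first by [].
  by apply/eqP/X0.
Qed.

End Dimension.

Theorem theorem3p6 (R : realType) (d : nat) (hd : (2 <= d)%N) :
  [/\ groebner_basis (@gens R d) (@Iideal R d),
      variety_dim (@Iideal R d) 3,
      is_prime_ideal (@Iideal R d)
    & forall p, @Iideal R d p <-> vanishing_ideal (@odeco_variety R d) p].
Proof.
split.
- exact: gens_groebner.
- by split; [exact: prime_chain3 | exact: no_prime_chain4].
- exact: Iideal_prime.
- by move=> p; apply: Iideal_vanishing; apply: ltnW.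
Qed.
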